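(* In the setting of the context (linearly degenerate $k$-th field, $A_{11}=\alpha E_{11}$), there is a constant $C_{10}>0$, depending only on $A,E,B,G$ and on $u^\ast$, such that the following holds. Let $u^+,\bar u,u_b\in\mathbb R^N$ be close to $u^\ast$ and let $s_k$, $(\xi_{\ell(u_b)+1},\dots,\xi_k)$, $(\xi'_{\ell(u_b)+1},\dots,\xi'_{k-1},s'_k,\dots,s'_N)$ be small reals such that $$\bar u=t_k(u^+,s_k),\qquad \beta\big(\phi(\bar u,\xi_{\ell(u_b)+1},\dots,\xi_k),u_b\big)=0,$$ $$\beta\big(\phi(\cdot,\xi'_{\ell(u_b)+1},\dots,\xi'_{k-1},s'_k)\circ t_{k+1}(\cdot,s'_{k+1})\circ\dots\circ t_N(u^+,s'_N),u_b\big)=0 .$$ Then $$\sum_{i=\ell(u_b)+1}^{k-1}|\xi_i-\xi'_i|+|s'_k-(\xi_k+s_k)|+\sum_{i=k+1}^N|s'_i|\le C_{10}\,|s_k|\Big(|\xi_k|+[\lambda_k(u^+)]^-\Big),$$ where $[\cdot]^-$ denotes the negative part.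
   Context: System. $g(v)_t+f(v)_x=0$ is considered together with its viscous approximation, which in variables $u$ (smooth change of variables $v=v(u)$) reads $E(u)u_t+A(u)u_x=B(u)u_{xx}+G(u,u_x)u_x$ with smooth coefficients. Write $u=(u_1,u_2)\in\mathbb R^h\times\mathbb R^{N-h}$, $h=\dim\ker B$, with corresponding blocks. For every $u$: $B=\mathrm{diag}(0_{h\times h},B_{22})$ with $B_{22}$ symmetric positive definite; $A=\begin{pmatrix}A_{11}&A_{21}^t\\ A_{21}&A_{22}\end{pmatrix}$ is symmetric; $E=\mathrm{diag}(E_{11},E_{22})$ is symmetric positive definite; $G=\begin{pmatrix}0&0\\ G_1&G_2\end{pmatrix}$, $G_1$ depending on $u$ and the last $N-h$ components of $u_x$ and vanishing when these vanish, $G_2$ depending on $u,u_x$ and vanishing when $u_x=0$. No eigenvector of $E^{-1}A(u)$ lies in $\ker B(u)$. $E^{-1}A(u)$ has $N$ distinct real eigenvalues with $\lambda_1<\dots<\lambda_{k-1}\le-c<0<c\le\lambda_{k+1}<\dots<\lambda_N$ and eigenvectors $r_1,\dots,r_N$; $\lambda_k(u^\ast)=0$. Each field is genuinely nonlinear or linearly degenerate, and the $k$-th is linearly degenerate: $\nabla\lambda_k\cdot r_k\equiv0$. Finally $A_{11}(u)=\alpha(u)E_{11}(u)$ for a scalar function $\alpha$, and whenever $\alpha(u)=0$ one has $\nabla\alpha(u)=(0_h^t,s^t)$ with $s$ a linear combination of the columns of $A_{21}(u)$. All states are in a sufficiently small neighborhood of $u^\ast$ and all parameters are sufficiently small. Boundary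 function. $\ell(u_b)$ is the number of non-positive eigenvalues of $A_{11}(u_b)$: $\ell(u_b)=0$ and $\beta(u,u_b)=u-u_b$ if $\alpha(u_b)>0$; $\ell(u_b)=h$ and $\beta(u,u_b)=(0_h,u_2-u_{2b})$ if $\alpha(u_b)\le0$. In both cases $\beta(u,u_b)=0$ iff $P(u)=P(u_b)$ for a linear projection $P$ of rank $N-\ell(u_b)$. Wave curves (of left states). $i_i(\widetilde u,\cdot)$ is the integral curve of $r_i$ with $i_i(\widetilde u,0)=\widetilde u$; $h_i(\widetilde u,\cdot)$ is the Hugoniot curve $f\circ v(h_i)-f\circ v(\widetilde u)=\sigma_i[g\circ v(h_i)-g\circ v(\widetilde u)]$ with $\sigma_i$ close to $\lambda_i(\widetilde u)$. If the $i$-th field is genuinely nonlinear, $t_i(\widetilde u,s)=i_i(\widetilde u,s)$ for $s<0$ and $h_i(\widetilde u,s)$ for $s\ge0$; if it is linearly degenerate (in particular for $i=k$), $t_i=i_i$. Center component. In the construction of Bianchini--Spinolo, the boundary layers (solutions of $A(u)u'=B(u)u''+G(u,u')u'$) lying on a center manifold are described, after rescaling the independent variable, by smooth functions $r_c(u,z_{00},\sigma)\in\mathbb R^N$ and $\theta_{00}(u,z_{00},\sigma)\in\mathbb R$ ($z_{00},\sigma\in\mathbb R$) satisfying $\theta_{00}(u,0,\lambda_k(u))=0$ and $r_c(u,0,\lambda_k(u))=r_k(u)$. Set $b_k(\widetilde u,s)=(u(s),z_{00}(s))\in\mathbb R^{N+1}$, where $\frac{du}{d\tau}=r_c(u,z_{00},0)$,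 $\frac{dz_{00}}{d\tau}=\theta_{00}(u,z_{00},0)$, $u(0)=\widetilde u$, $z_{00}(0)=0$. Set $\gamma_k(\widetilde u,s)=(t_k(\widetilde u,s),0)$ if $\lambda_k(\widetilde u)\ge0$ and $\gamma_k(\widetilde u,s)=b_k(\widetilde u,s)$ if $\lambda_k(\widetilde u)<0$; $\zeta_k(\widetilde u,s)$ denotes the first $N$ components of $\gamma_k(\widetilde u,s)$. The map $\phi$. With $\xi=(\xi_{\ell(u_b)+1},\dots,\xi_{k-1})$, $\phi(\widetilde u,\xi,s_k)=\psi_s(\zeta_k(\widetilde u,s_k),\xi)+\psi_p(\widetilde u,\xi,s_k)$, where $\psi_s(\check u,\cdot)$ is the Lipschitz parametrization (projected onto the $u$ variables) of the stable manifold of boundary layers converging exponentially to $\check u$, $\psi_s(\check u,0)=\check u$, and $\psi_p$ is the interaction term of the Slaving Manifold Theorem, i.e. a Lipschitz function of $(\zeta_k(\widetilde u,s_k),\gamma_k(\widetilde u,s_k),\xi)$ such that boundary layers with initial datum $\phi(\widetilde u,\xi,s_k)$ have the same asymptotic behavior as the center-manifold orbit starting at $\gamma_k(\widetilde u,s_k)$; it satisfies $|\psi_p|\le C|s_k||\xi|$ if $\lambda_k(\widetilde u)<0$ and $\psi_p=0$ if $\lambda_k(\widetilde u)\ge0$. It is part of the known theory (Bianchini--Spinolo, via Clarke's theorem) that the map $(\xi',s'_k,\dots,s'_N)\mapsto P\big(\phi(\cdot,\xi',s'_k)\circ t_{k+1}(\cdot,s'_{k+1})\circ\dots\circ t_N(u^+,s'_N)\big)$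 is locally invertible onto the range of $P$ with Lipschitz inverse, uniformly for $u^+$ near $u^\ast$. *)

(* Defs.v *)
From HB Require Import structures.
From mathcomp Require Import all_boot all_order all_algebra.
From mathcomp Require Import all_classical all_reals all_analysis.

Set Implicit Arguments.
Unset Strict Implicit.
Unset Printing Implicit Defensive.

Import Order.TTheory GRing.Theory Num.Theory.
Import numFieldNormedType.Exports.

Local Open Scope classical_set_scope.
Local Open Scope ring_scope.

Section Calculus.
Context {R : realType}.

Fixpoint iter_derive {V W : normedModType R} (vs : seq V) (F : V -> W) : V -> W :=
  if vs is v :: vs' then fun x => 'D_v (iter_derive vs' F) x else F.

(* C^oo on a set, meant for open sets: all iterated directional derivatives
   exist and are Frechet differentiable, hence continuous. *)
Definition smooth_on {V W : normedModType R} (D : set V) (F : V -> W) : Prop :=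
  forall (vs : seq V) (x : V), D x -> differentiable (iter_derive vs F) x.

Definition gradient {n : nat} (F : 'cV[R]_n -> R) (u : 'cV[R]_n) : 'cV[R]_n :=
  \col_i 'D_(delta_mx i 0) F u.

(* The library's jacobian is for row vectors. *)
Definition jac {n p : nat} (F : 'cV[R]_n -> 'cV[R]_p) (u : 'cV[R]_n) :
    'M[R]_(p, n) :=
  \matrix_(i, j) ('D_(delta_mx j 0) F u) i 0.

Definition symmetric_posdef {n : nat} (M : 'M[R]_n) : Prop :=
  M^T = M /\ forall w : 'cV[R]_n, w != 0 -> 0 < (w^T *m M *m w) 0 0.

Definition neg_part (x : R) : R := Num.max (- x) 0.

Definition norm1 {n : nat} (x : 'cV[R]_n) : R := \sum_i `|x i 0|.

End Calculus.

(* The number N of unknowns is h + m, and u = col_mx u1 u2 with u1 of size h.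
   Characteristic fields are indexed from 0, so that the characteristic field
   k : 'I_(h + m) is preceded by exactly k fields. *)
Record system (R : realType) (h m : nat) := System {
  sys_dom : set 'cV[R]_(h + m);
  sys_ref : 'cV[R]_(h + m);
  sys_cons : 'cV[R]_(h + m) -> 'cV[R]_(h + m);
  sys_flux : 'cV[R]_(h + m) -> 'cV[R]_(h + m);
  sys_var : 'cV[R]_(h + m) -> 'cV[R]_(h + m);
  sys_E : 'cV[R]_(h + m) -> 'M[R]_(h + m);
  sys_A : 'cV[R]_(h + m) -> 'M[R]_(h + m);
  sys_B : 'cV[R]_(h + m) -> 'M[R]_(h + m);
  sys_G : 'cV[R]_(h + m) -> 'cV[R]_(h + m) -> 'M[R]_(h + m);
  sys_alpha : 'cV[R]_(h + m) -> R;
  sys_lambda : 'I_(h + m) -> 'cV[R]_(h + m) -> R;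
  sys_r : 'I_(h + m) -> 'cV[R]_(h + m) -> 'cV[R]_(h + m);
  sys_k : 'I_(h + m)
}.

Section System.
Context {R : realType} {h m : nat} (S : system R h m).
Local Notation V := 'cV[R]_(h + m).
Local Notation U := (sys_dom S).
Local Notation ustar := (sys_ref S).
Local Notation g := (sys_cons S).
Local Notation f := (sys_flux S).
Local Notation v := (sys_var S).
Local Notation E := (sys_E S).
Local Notation A := (sys_A S).
Local Notation B := (sys_B S).
Local Notation G := (sys_G S).
Local Notation alpha := (sys_alpha S).
Local Notation lambda := (sys_lambda S).
Local Notation r := (sys_r S).
Local Notation k := (sys_k S).

(* E(u) u_t + A(u) u_x is g(v)_t + f(v)_x for v = v(u), up to multiplication on
   the left by an invertible matrix M(u). *)
Definition change_of_variables : Prop :=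
  [/\ smooth_on U v,
      {in U &, injective v},
      forall u, U u -> jac v u \in unitmx,
      exists D : set V, [/\ open D, v @` U `<=` D, smooth_on D g & smooth_on D f]
    & exists M : V -> 'M[R]_(h + m), forall u, U u ->
        [/\ M u \in unitmx,
            M u *m jac (g \o v) u = E u
          & M u *m jac (f \o v) u = A u] ].

Definition smooth_coefficients : Prop :=
  [/\ smooth_on U E, smooth_on U A, smooth_on U B
    & smooth_on [set w : V * V | U w.1] (fun w => G w.1 w.2)].

Definition block_structure : Prop :=
  (forall u, U u ->
    [/\ exists2 B22 : 'M[R]_m,
          symmetric_posdef B22 & B u = block_mx 0 0 0 B22,
        (A u)^T = A u,
        exists E11 E22, E u = block_mx E11 0 0 E22
      & symmetric_posdef (E u)]) /\
  exists (G1 : V -> 'cV[R]_m -> 'M[R]_(m, h)) (G2 : V -> V -> 'M[R]_m),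
    forall u, U u ->
      [/\ forall p, G u p = block_mx 0 0 (G1 u (dsubmx p)) (G2 u p),
          G1 u 0 = 0
        & G2 u 0 = 0].

Definition no_eigenvector_in_kernel : Prop :=
  forall u (w : V) (mu : R), U u ->
    w != 0 -> invmx (E u) *m A u *m w = mu *: w -> B u *m w != 0.

Definition strict_hyperbolicity : Prop :=
  [/\ forall i, smooth_on U (lambda i),
      forall i, smooth_on U (r i),
      forall i u, U u ->
        r i u != 0 /\ invmx (E u) *m A u *m r i u = lambda i u *: r i u
    & forall (i j : 'I_(h + m)) u, U u -> (i < j)%N -> lambda i u < lambda j u].

Definition characteristic_field : Prop :=
  lambda k ustar = 0 /\
  exists2 c : R, 0 < c & forall (i : 'I_(h + m)) u, U u ->
    ((i < k)%N -> lambda i u <= - c) /\ ((k < i)%N -> c <= lambda i u).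

Definition linearly_degenerate (i : 'I_(h + m)) : Prop :=
  forall u, U u -> ((gradient (lambda i) u)^T *m r i u) 0 0 = 0.

Definition genuinely_nonlinear (i : 'I_(h + m)) : Prop :=
  forall u, U u -> ((gradient (lambda i) u)^T *m r i u) 0 0 != 0.

Definition alpha_structure : Prop :=
  [/\ smooth_on U alpha,
      forall u, U u -> ulsubmx (A u) = alpha u *: ulsubmx (E u)
    & forall u, U u -> alpha u = 0 ->
        exists c : 'cV[R]_h, gradient alpha u = col_mx 0 (dlsubmx (A u) *m c)].

Definition system_hypotheses : Prop :=
  [/\ open U /\ U ustar,
      change_of_variables,
      smooth_coefficients /\ block_structure,
      no_eigenvector_in_kernel
    & [/\ strict_hyperbolicity, characteristic_field,
          forall i, genuinely_nonlinear i \/ linearly_degenerate i,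
          linearly_degenerate k
        & alpha_structure] ].

(* Non-positive eigenvalues of A_11, counted with algebraic multiplicity. *)
Definition ell (ub : V) : nat :=
  \big[addn/0%N]_(x \in [set x : R | x <= 0])
    mup x (char_poly (ulsubmx (A ub))).

Definition beta (u ub : V) : V :=
  if 0 < alpha ub then u - ub else col_mx 0 (dsubmx u - dsubmx ub).

Definition bproj (ub : V) : 'M[R]_(h + m) :=
  if 0 < alpha ub then 1%:M else block_mx 0 0 0 1%:M.

Lemma beta_eq0 (u ub : V) : beta u ub = 0 <-> bproj ub *m u = bproj ub *m ub.
Proof.
have -> : beta u ub = bproj ub *m u - bproj ub *m ub.
  rewrite /beta /bproj; case: ifP => _; first by rewrite !mul1mx.
  rewrite -mulmxBr -[X in _ *m X]vsubmxK mul_block_col !mul0mx !mul1mx !add0r.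
  by rewrite raddfB.
by split=> [/eqP|->]; [rewrite subr_eq0 => /eqP | rewrite subrr].
Qed.

Definition layer_eq (w : R -> V) (x : R) : Prop :=
  [/\ derivable w x 1, derivable (derive1 w) x 1
    & A (w x) *m derive1 w x =
      B (w x) *m derive1 (derive1 w) x + G (w x) (derive1 w x) *m derive1 w x].

Definition boundary_layer (w : R -> V) : Prop :=
  [/\ {within `[0, +oo[, continuous w},
      forall x, 0 <= x -> U (w x)
    & forall x, 0 < x -> layer_eq w x].

End System.

Record wave_curves (R : realType) (h m : nat) := WaveCurves {
  icurve : 'I_(h + m) -> 'cV[R]_(h + m) -> R -> 'cV[R]_(h + m);
  hcurve : 'I_(h + m) -> 'cV[R]_(h + m) -> R -> 'cV[R]_(h + m);
  hspeed : 'I_(h + m) -> 'cV[R]_(h + m) -> R -> R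
}.

Section WaveCurves.
Context {R : realType} {h m : nat} (S : system R h m) (W : wave_curves R h m).
Local Notation V := 'cV[R]_(h + m).
Local Notation U := (sys_dom S).
Local Notation ustar := (sys_ref S).
Local Notation g := (sys_cons S).
Local Notation f := (sys_flux S).
Local Notation v := (sys_var S).
Local Notation lambda := (sys_lambda S).
Local Notation r := (sys_r S).
Local Notation k := (sys_k S).

Definition integral_curves : Prop :=
  exists2 rho : R, 0 < rho & forall i (u : V), `|u - ustar| < rho ->
    icurve W i u 0 = u /\
    forall s : R, `|s| < rho ->
      U (icurve W i u s) /\ is_derive s 1 (icurve W i u) (r i (icurve W i u s)).

(* The curve is parametrized so that its tangent vector at the origin is r_i. *)
Definition hugoniot_curves : Prop :=
  (exists2 rho : R, 0 < rho & forall i,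
    smooth_on [set w : V * R | `|w.1 - ustar| < rho /\ `|w.2| < rho]
      (fun w => hcurve W i w.1 w.2) /\
    forall u : V, `|u - ustar| < rho ->
      [/\ hcurve W i u 0 = u,
          is_derive (0 : R) 1 (hcurve W i u) (r i u)
        & forall s : R, `|s| < rho ->
            U (hcurve W i u s) /\
            f (v (hcurve W i u s)) - f (v u) =
              hspeed W i u s *: (g (v (hcurve W i u s)) - g (v u))]) /\
  (forall (i : 'I_(h + m)) (eps : R), 0 < eps ->
     exists2 rho : R, 0 < rho & forall (u : V) (s : R),
       `|u - ustar| < rho -> `|s| < rho -> `|hspeed W i u s - lambda i u| < eps).

Definition wave_curves_hypotheses : Prop := integral_curves /\ hugoniot_curves.

Definition tcurve (i : 'I_(h + m)) (u : V) (s : R) : V :=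
  if `[< genuinely_nonlinear S i >] && (0 <= s) then hcurve W i u s
  else icurve W i u s.

(* t_{k+1}(., s_{k+1}) o ... o t_N(u, s_N); only the s_i with i > k matter. *)
Definition fast_waves (u : V) (s : 'I_(h + m) -> R) : V :=
  foldr (fun i w => tcurve i w (s i)) u
    [seq i : 'I_(h + m) <- enum 'I_(h + m) | (k < i)%N].

End WaveCurves.

(* The stable manifold and the interaction term depend on l = ell u_b, through
   the number k - l of the parameters xi_{l+1}, ..., xi_{k-1}. *)
Record layer_construction (R : realType) (h m : nat) (k : 'I_(h + m)) :=
    LayerConstruction {
  lay_dom : set ('cV[R]_(h + m) * R * R);
  lay_rc : 'cV[R]_(h + m) -> R -> R -> 'cV[R]_(h + m);
  lay_theta : 'cV[R]_(h + m) -> R -> R -> R;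
  lay_b : 'cV[R]_(h + m) -> R -> 'cV[R]_(h + m) * R;
  lay_psis : forall l : nat,
    'cV[R]_(h + m) -> 'cV[R]_(k - l) -> 'cV[R]_(h + m);
  lay_psip : forall l : nat,
    'cV[R]_(h + m) -> 'cV[R]_(h + m) * R -> 'cV[R]_(k - l) -> 'cV[R]_(h + m)
}.

Section Layers.
Context {R : realType} {h m : nat} (S : system R h m) (W : wave_curves R h m).
Local Notation V := 'cV[R]_(h + m).
Local Notation U := (sys_dom S).
Local Notation ustar := (sys_ref S).
Local Notation lambda := (sys_lambda S).
Local Notation r := (sys_r S).
Local Notation k := (sys_k S).
Context (L : layer_construction R k).
Local Notation Omega := (lay_dom L).
Local Notation rc := (lay_rc L).
Local Notation theta := (lay_theta L).
Local Notation bk := (lay_b L).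
Local Notation psis := (lay_psis L).
Local Notation psip := (lay_psip L).

(* The equation on the center manifold {u_x = z r_c(u, z, 0)}, in the space
   variable x: the rescaled variable tau is given by d tau = z dx. *)
Definition center_eq (w : R -> V) (z : R -> R) (x : R) : Prop :=
  [/\ Omega (w x, z x, 0),
      is_derive x 1 w (z x *: rc (w x) (z x) 0)
    & is_derive x 1 z (z x * theta (w x) (z x) 0)].

Definition center_component : Prop :=
  [/\ open Omega /\ Omega (ustar, 0, 0),
      smooth_on Omega (fun p => rc p.1.1 p.1.2 p.2) /\
      smooth_on Omega (fun p => theta p.1.1 p.1.2 p.2),
      forall (u : V) (z sigma : R), Omega (u, z, sigma) -> U u,
      forall u : V, Omega (u, 0, lambda k u) ->
        theta u 0 (lambda k u) = 0 /\ rc u 0 (lambda k u) = r k u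
    & forall (a b : R) (w : R -> V) (z : R -> R),
        (forall x, x \in `]a, b[ -> center_eq w z x) ->
        forall x, x \in `]a, b[ -> layer_eq S w x].

Definition center_curve : Prop :=
  exists2 rho : R, 0 < rho & forall u : V, `|u - ustar| < rho ->
    bk u 0 = (u, 0) /\
    forall s : R, `|s| < rho ->
      [/\ Omega (bk u s, 0),
          is_derive s 1 (fun tau => (bk u tau).1) (rc (bk u s).1 (bk u s).2 0)
        & is_derive s 1 (fun tau => (bk u tau).2)
            (theta (bk u s).1 (bk u s).2 0)].

Definition gamma (u : V) (s : R) : V * R :=
  if 0 <= lambda k u then (tcurve S W k u s, 0) else bk u s.

Definition zeta (u : V) (s : R) : V := (gamma u s).1.

Definition phi (l : nat) (u : V) (xi : 'cV[R]_(k - l)) (s : R) : V :=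
  psis (zeta u s) xi + psip (zeta u s) (gamma u s) xi.

(* [u0] is the initial datum of a layer converging to [u] at the rate c. *)
Definition stable_datum (kappa c : R) (u u0 : V) : Prop :=
  exists w : R -> V, [/\ boundary_layer S w, w 0 = u0,
    forall x, 0 <= x -> `|w x - u| <= kappa * expR (- (c * x))
  & forall x, 0 < x -> `|dsubmx (derive1 w x)| <= kappa * expR (- (c * x))].

(* [psis (ell S u) u] is onto the data of all layers converging to [u] at a fixed
   rate c, which excludes the slow decay along the center manifold. *)
Definition stable_manifold : Prop :=
  exists rho c lip kappa kappa' : R,
    [/\ [/\ 0 < rho, 0 < c & 0 < kappa'],
        forall (ub u u' : V) (xi xi' : 'cV[R]_(k - ell S ub)),
          `|ub - ustar| < rho -> `|u - ustar| < rho -> `|u' - ustar| < rho ->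
          norm1 xi < rho -> norm1 xi' < rho ->
          `|psis u xi - psis u' xi'| <= lip * (`|u - u'| + norm1 (xi - xi')),
        forall ub u : V, `|ub - ustar| < rho -> `|u - ustar| < rho ->
          psis u (0 : 'cV[R]_(k - ell S ub)) = u
      & forall u : V, `|u - ustar| < rho ->
          (forall xi : 'cV[R]_(k - ell S u), norm1 xi < rho ->
             stable_datum kappa c u (psis u xi)) /\
          (forall u0 : V, stable_datum kappa' c u u0 ->
             exists2 xi : 'cV[R]_(k - ell S u), norm1 xi < rho
                                              & u0 = psis u xi)].

Definition interaction_term : Prop :=
  exists rho lip C : R,
    [/\ 0 < rho,
        forall (ub u u' : V) (p p' : V * R) (xi xi' : 'cV[R]_(k - ell S ub)),
          `|ub - ustar| < rho ->
          `|u - ustar| < rho -> `|p - (ustar, 0)| < rho -> norm1 xi < rho ->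
          `|u' - ustar| < rho -> `|p' - (ustar, 0)| < rho -> norm1 xi' < rho ->
          `|psip u p xi - psip u' p' xi'|
            <= lip * (`|u - u'| + `|p - p'| + norm1 (xi - xi'))
      & forall (ub u : V) (xi : 'cV[R]_(k - ell S ub)) (s : R),
          `|ub - ustar| < rho -> `|u - ustar| < rho ->
          norm1 xi < rho -> `|s| < rho ->
          (lambda k u < 0 ->
             `|psip (zeta u s) (gamma u s) xi| <= C * `|s| * norm1 xi) /\
          (0 <= lambda k u -> psip (zeta u s) (gamma u s) xi = 0)].

(* The orbit (w, z) of the center manifold starts at gamma(u, s); the restriction
   on ell keeps the limit of the layer on the same side of {alpha = 0} as the
   states for which the stable manifold has dimension k - ell u_b. *)
Definition slaving : Prop :=
  exists rho c kappa : R, [/\ 0 < rho, 0 < c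
    & forall (ub u : V) (xi : 'cV[R]_(k - ell S ub)) (s : R),
        `|ub - ustar| < rho -> `|u - ustar| < rho ->
        norm1 xi < rho -> `|s| < rho -> ell S (zeta u s) = ell S ub ->
        exists (w0 w : R -> V) (z : R -> R),
          [/\ boundary_layer S w0 /\ w0 0 = phi u xi s,
              {within `[0, +oo[, continuous w} /\
              {within `[0, +oo[, continuous z},
              (w 0, z 0) = gamma u s,
              forall x, 0 < x -> center_eq w z x
            & forall x, 0 <= x ->
                `|w0 x - w x| <= kappa * expR (- (c * x))] ].

(* phi(., xi, s_k) o t_{k+1}(., s_{k+1}) o ... o t_N(u, s_N) *)
Definition full_map (l : nat) (u : V) (xi : 'cV[R]_(k - l))
    (s : 'I_(h + m) -> R) : V :=
  phi (fast_waves S W u s) xi (s k).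

(* Injectivity with Lipschitz inverse near the origin, and surjectivity onto a
   neighborhood of the value P u at the origin in the range of P. *)
Definition locally_invertible : Prop :=
  exists rho rho' lip : R,
    [/\ 0 < rho, 0 < rho'
      & forall ub u : V, `|ub - ustar| < rho -> `|u - ustar| < rho ->
        (forall (xi xi' : 'cV[R]_(k - ell S ub)) (s s' : 'I_(h + m) -> R),
          norm1 xi < rho -> norm1 xi' < rho ->
          (forall i : 'I_(h + m), (k <= i)%N -> `|s i| < rho /\ `|s' i| < rho) ->
          norm1 (xi - xi') + \sum_(i < h + m | (k <= i)%N) `|s i - s' i|
            <= lip * `|bproj S ub *m full_map u xi s -
                       bproj S ub *m full_map u xi' s'|) /\
        (forall y : V, `|bproj S ub *m y - bproj S ub *m u| < rho' ->
          exists (xi : 'cV[R]_(k - ell S ub)) (s : 'I_(h + m) -> R),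
            [/\ norm1 xi < rho,
                forall i : 'I_(h + m), (k <= i)%N -> `|s i| < rho
              & bproj S ub *m full_map u xi s = bproj S ub *m y])].

Definition layer_hypotheses : Prop :=
  [/\ center_component /\ center_curve,
      stable_manifold,
      interaction_term,
      slaving
    & locally_invertible].

End Layers.

(* Main.v *)
Require Import Defs.
From HB Require Import structures.
From mathcomp Require Import all_boot all_order all_algebra.
From mathcomp Require Import all_classical all_reals all_analysis.
From mathcomp Require Import ring lra.

(* The contact curve through u+ is an orbit of r_k, along which lambda_k is
   constant; it therefore solves the ODE of the center curve b_k up to an error
   O(|lambda_k(u+)|), because r_c(w, 0, lambda_k(w)) = r_k(w) and
   theta_00(w, 0, lambda_k(w)) = 0.  By Gronwall, gamma_k(u+, xi_k + s_k) and
   gamma_k(ubar, xi_k) differ by O(|s_k| [lambda_k(u+)]^-); if lambda_k(u+) >= 0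
   they coincide, both lying on one orbit of r_k.  So phi(ubar, xi, xi_k) is that
   close to the value at u+ of the full map with parameters
   (xi, xi_k + s_k, 0, ..., 0), and its Lipschitz inverse gives the estimate. *)

Set Implicit Arguments.
Unset Strict Implicit.
Unset Printing Implicit Defensive.

Import Order.TTheory GRing.Theory Num.Theory.
Import numFieldNormedType.Exports.

Local Open Scope classical_set_scope.
Local Open Scope ring_scope.

(** * Mean value inequalities and a short-time Gronwall estimate for curves in normed spaces *)

Section MeanValue.
Context {R : realType}.

Lemma is_derive_comp {V W : normedModType R} (f : R -> V) (F : V -> W) (t : R) v :
  is_derive t 1 f v -> differentiable F (f t) ->
  is_derive t 1 (fun t => F (f t)) ('D_v F (f t)).
Proof.
move=> [fDt fDE] FD.
have fd : differentiable f t by apply/derivable1_diffP.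
apply: DeriveDef; first by apply/derivable1_diffP; exact: differentiable_comp.
rewrite deriveE; last exact: differentiable_comp.
by rewrite diff_comp //= -(deriveE _ fd) fDE deriveE.
Qed.

Context {V : normedModType R}.
Implicit Types (f df : R -> V) (K s : R).

(** Continuity argument: let [c] be the supremum of the times at which the estimate holds. The
    estimate is closed, so it holds at [c]; there it yields the strict bound on [df c], which
    carries the estimate beyond [c] unless [c = b]. *)
Lemma mean_value_bootstrap_ge0 f df (K b : R) : 0 <= b ->
  (forall t : R, 0 <= t <= b -> is_derive t 1 f (df t)) ->
  (forall t : R, 0 <= t <= b -> `|f t - f 0| <= K * t -> `|df t| < K) ->
  `|f b - f 0| <= K * b.
Proof.
move=> b0 fD fK.
pose A := [set t : R | 0 <= t <= b /\ `|f t - f 0| <= K * t].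
have A0 : A 0 by rewrite /A /= lexx b0 subrr normr0 mulr0.
have Aub : has_ubound A by exists b => t [/andP[]].
have Asup : has_sup A by split=> //; exists 0.
set c := sup A.
have c0b : 0 <= c <= b.
  by rewrite ub_le_sup //= ge_sup //; [exists 0 | move=> t [/andP[]]].
have fc : `|f c - f 0| <= K * c.
  (* Otherwise the estimate would fail on a whole neighborhood of [c], which must meet [A] because a
     supremum lies in the closure. *)
  rewrite leNgt; apply/negP => Kc.
  have [fDc _] := fD _ c0b.
  have fC : {for c, continuous f}.
    by apply: differentiable_continuous; apply/derivable1_diffP.
  have gC : (fun t => `|f t - f 0| - K * t) @ c --> `|f c - f 0| - K * c.
    apply: cvgB; last by apply: cvgM; [exact: cvg_cst | exact: cvg_id].
    by apply: cvg_norm; apply: cvgB => //; exact: cvg_cst.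
  have g0 : \forall t \near c, 0 < `|f t - f 0| - K * t.
    by apply: (cvgr_gt _ gC); rewrite subr_gt0.
  have [t [[_ tK] /=]] := closure_sup (ex_intro _ 0 A0) Aub g0.
  by rewrite subr_gt0 ltNge tK.
have [cb|bc] := ltP c b; last first.
  by have -> : b = c by apply/le_anti; rewrite bc; case/andP: c0b.
have [fDc fDE] := fD _ c0b.
(* The difference quotients at [c] tend to [df c], so they eventually have norm below [K]; a step
   [d] in their range that does not pass [b] gives a point of [A] beyond [c]. *)
have dK : \forall h \near 0^', `|h^-1 *: ((f \o shift c) (h *: 1) - f c)| < K.
  apply: (cvgr_lt `|df c|); last exact: fK.
  by apply: cvg_norm; rewrite -fDE; exact: fDc.
have {dK}[e /= e0 dK] := dK.
pose d := Num.min (e / 2) (b - c).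
have d0 : 0 < d by rewrite lt_min divr_gt0 ?subr_gt0.
have dAc : A (d + c).
  have db : d <= b - c by rewrite ge_min lexx orbT.
  split; first by case/andP: c0b => c0 _; apply/andP; split; lra.
  have := dK d; rewrite /= sub0r normrN gtr0_norm // gt_eqF // /GRing.scale/= mulr1.
  have -> : d < e.
    have : d <= e / 2 by rewrite ge_min lexx.
    by move: e0; lra.
  move=> /(_ isT isT); rewrite normrZ normfV gtr0_norm // => dfK.
  have {}dfK : `|f (d + c) - f c| <= K * d.
    by rewrite -ler_pdivrMr // mulrC ltW.
  rewrite -(subrK (f c) (f (d + c))) -addrA mulrDr.
  by apply: (le_trans (ler_normD _ _)); exact: lerD.
by have := ub_le_sup Aub dAc; rewrite -/c; move: d0; lra.
Qed.

(* The bound on [df] may use the conclusion, which rules out leaving a region. *)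
Lemma mean_value_bootstrap f df K s :
  (forall t : R, `|t| <= `|s| -> is_derive t 1 f (df t)) ->
  (forall t : R, `|t| <= `|s| -> `|f t - f 0| <= K * `|t| -> `|df t| < K) ->
  `|f s - f 0| <= K * `|s|.
Proof.
move=> fD fK; have [s0|s0] := leP 0 s.
  have tE t : 0 <= t <= s -> `|t| = t /\ `|t| <= `|s|.
    by case/andP=> t0 ts; rewrite !ger0_norm.
  rewrite (ger0_norm s0); apply: (mean_value_bootstrap_ge0 s0) => t /tE[tE1 tE2].
    exact: fD.
  by have := fK _ tE2; rewrite tE1.
have s'0 : 0 <= - s by rewrite oppr_ge0 ltW.
have tE t : 0 <= t <= - s -> `|- t| = t /\ `|- t| <= `|s|.
  by case/andP=> t0 ts; rewrite normrN ger0_norm // ltr0_norm.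
have := @mean_value_bootstrap_ge0 (f \o -%R) (fun t => - df (- t)) K _ s'0.
rewrite /= opprK oppr0 (ltr0_norm s0); apply=> t /tE[tE1 tE2].
  have [fDt fDE] := fD _ tE2.
  have fd : differentiable f (- t) by apply/derivable1_diffP.
  have := is_derive_comp (is_deriveNid t 1) fd.
  by rewrite (deriveE _ fd) linearN -(deriveE _ fd) fDE.
by rewrite normrN; have := fK _ tE2; rewrite tE1.
Qed.

(** The bootstrap needs a strict bound, so it is applied with [K + d] and [d] tends to 0. Dividing
    by [1 + |s|] instead of [|s|] covers [s = 0]. *)
Lemma mean_value_le f df K s :
  (forall t : R, `|t| <= `|s| -> is_derive t 1 f (df t)) ->
  (forall t : R, `|t| <= `|s| -> `|df t| <= K) ->
  `|f s - f 0| <= K * `|s|.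
Proof.
move=> fD fK; apply/ler_addgt0Pr => e e0.
pose d := e / (1 + `|s|).
have s1 : 0 < 1 + `|s| by rewrite ltr_pwDl.
have d0 : 0 < d by rewrite divr_gt0.
have -> : e = d * (1 + `|s|) by rewrite divfK // gt_eqF.
have : `|f s - f 0| <= (K + d) * `|s|.
  apply: mean_value_bootstrap fD _ => t ts _.
  by apply: (le_lt_trans (fK _ ts)); rewrite ltrDl.
by move/le_trans; apply; rewrite mulrDl lerD2l ler_pM2l // lerDr.
Qed.

(** On times with [lip * |s| <= 1 / 2] a bootstrap replaces the exponential: as long as [x - y] has
    moved by at most [(K + d) * |s|], its derivative is at most [(K + d) / 2 + K / 2], which is
    below [K + d]. *)
Lemma gronwall_short (x y dx dy : R -> V) (lip e s : R) :
  0 <= lip -> lip * `|s| <= 1 / 2 ->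
  (forall t : R, `|t| <= `|s| -> is_derive t 1 x (dx t)) ->
  (forall t : R, `|t| <= `|s| -> is_derive t 1 y (dy t)) ->
  (forall t : R, `|t| <= `|s| -> `|dx t - dy t| <= lip * `|x t - y t| + e) ->
  `|x s - y s| <= 2 * `|x 0 - y 0| + 2 * e * `|s|.
Proof.
move=> lip0 lips xD yD xyE.
set K := 2 * (lip * `|x 0 - y 0| + e).
suff H d : 0 < d -> `|(x s - y s) - (x 0 - y 0)| <= (K + d) * `|s|.
  have {}H : `|(x s - y s) - (x 0 - y 0)| <= K * `|s|.
    apply/ler_addgt0Pr => d d0; have s1 : 0 < 1 + `|s| by rewrite ltr_pwDl.
    have d'0 : 0 < d / (1 + `|s|) by rewrite divr_gt0.
    apply: (le_trans (H _ d'0)); rewrite mulrDl lerD2l -mulrA ger_pMr //.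
    by rewrite ler_pdivrMl // mulr1 lerDr.
  rewrite -(subrK (x 0 - y 0) (x s - y s)); apply: (le_trans (ler_normD _ _)).
  have : K * `|s| = 2 * (lip * `|s|) * `|x 0 - y 0| + 2 * e * `|s|.
    by rewrite /K; ring.
  have : (lip * `|s|) * `|x 0 - y 0| <= 1 / 2 * `|x 0 - y 0|.
    exact: ler_wpM2r.
  by move: H; lra.
(* No sign is assumed for [e]; that of [K] comes from the bound on the derivatives at time 0. *)
have K0 : 0 <= K.
  have := le_trans (normr_ge0 _) (xyE 0 _); rewrite normr0 => /(_ (normr_ge0 _)).
  by rewrite /K; lra.
move=> d0; apply: (@mean_value_bootstrap (x \- y) (dx \- dy)) => t ts /=.
  by apply: is_deriveB; [exact: xD|exact: yD].
move=> xyt; apply: (le_lt_trans (xyE _ ts)).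
have {}xyt : `|x t - y t| <= (K + d) * `|s| + `|x 0 - y 0|.
  rewrite -(subrK (x 0 - y 0) (x t - y t)); apply: (le_trans (ler_normD _ _)).
  rewrite lerD2r; apply: (le_trans xyt); rewrite ler_wpM2l // addr_ge0 //.
  exact: ltW.
have : lip * `|x t - y t| <= lip * ((K + d) * `|s| + `|x 0 - y 0|).
  exact: ler_wpM2l.
have : (lip * `|s|) * (K + d) <= 1 / 2 * (K + d).
  by apply: ler_wpM2r => //; rewrite addr_ge0 // ltW.
have : K = 2 * (lip * `|x 0 - y 0| + e) by [].
by move: d0; clearbody K; lra.
Qed.
End MeanValue.

(** * Smooth maps on finite-dimensional spaces are locally Lipschitz *)

Section LocalLipschitz.
Context {R : realType}.

Lemma norm_coord_le m n (A : 'M[R]_(m, n)) i j : `|A i j| <= `|A|.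
Proof.
rewrite {2}/Num.norm /= mx_normrE.
exact: (le_bigmax _ (fun ij => `|A ij.1 ij.2|) (i, j)).
Qed.

(* Finite dimensionality, in the form that bounds a differential by finitely many
   directional derivatives. *)
Definition has_coordinates (E : normedModType R) : Prop :=
  exists (I : finType) (e : I -> E) (c : I -> E -> R), forall w : E,
    w = \sum_i c i w *: e i /\ forall i, `|c i w| <= `|w|.

Lemma has_coordinates_cV n : has_coordinates 'cV[R]_n.
Proof.
exists 'I_n, (fun i => delta_mx i 0), (fun i (w : 'cV[R]_n) => w i 0) => w; split.
  by rewrite {1}[w]matrix_sum_delta; apply: eq_bigr => i _; rewrite big_ord1.
by move=> i; exact: norm_coord_le.
Qed.

Lemma has_coordinates_R : has_coordinates (R : normedModType R).
Proof.
exists unit, (fun=> 1), (fun=> id) => w; split=> //.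
by rewrite big_const card_unit /= addr0 /GRing.scale /= mulr1.
Qed.

Lemma has_coordinates_prod (E F : normedModType R) :
  has_coordinates E -> has_coordinates F -> has_coordinates (E * F)%type.
Proof.
move=> [I [e [c ec]]] [J [e' [c' ec']]].
exists (I + J)%type, (fun k => match k with inl i => (e i, 0) | inr j => (0, e' j) end).
exists (fun k w => match k with inl i => c i w.1 | inr j => c' j w.2 end).
move=> w; split; last first.
  case=> [i|j]; rewrite prod_normE le_max.
    by rewrite (ec w.1).2.
  by rewrite (ec' w.2).2 orbT.
rewrite big_sumType /=.
have -> : \sum_i c i w.1 *: ((e i, 0) : E * F) = (w.1, 0).
  rewrite {2}(ec w.1).1 (big_morph (fun a : E => (a, 0 : F)) (id1 := 0) (op1 := +%R)) //.
    by apply: eq_bigr => i _; congr (_, _); rewrite /= scaler0.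
  by move=> a b; congr (_, _); rewrite /= addr0.
have -> : \sum_j c' j w.2 *: ((0, e' j) : E * F) = (0, w.2).
  rewrite {2}(ec' w.2).1 (big_morph (fun a : F => (0 : E, a)) (id1 := 0) (op1 := +%R)) //.
    by apply: eq_bigr => i _; congr (_, _); rewrite /= scaler0.
  by move=> a b; congr (_, _); rewrite /= addr0.
by case: w => a b; congr (_, _) => /=; rewrite ?addr0 ?add0r.
Qed.

Lemma derive_sum_coordinates {E W : normedModType R} (I : finType) (e : I -> E)
    (c : I -> R) (F : E -> W) p : differentiable F p ->
  'D_(\sum_i c i *: e i) F p = \sum_i c i *: 'D_(e i) F p.
Proof.
move=> FD; rewrite deriveE // linear_sum; apply: eq_bigr => i _.
by rewrite linearZ /= -deriveE.
Qed.

Lemma is_derive_line {E : normedModType R} (q v : E) (t : R) :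
  is_derive t 1 (fun t : R => q + t *: v) v.
Proof.
have dl : is_diff t (fun t : R => t *: v) ( *:%R^~ v) by exact: is_diff_scalel.
have dv : is_derive t 1 (fun t : R => t *: v) v.
  have [ld lE] := dl; apply: DeriveDef; first by apply/derivable1_diffP.
  by rewrite deriveE // lE scale1r.
by rewrite -[X in is_derive _ _ _ X]add0r; apply: is_deriveD.
Qed.

(** The derivatives along the finitely many coordinate vectors are continuous at [p0], hence bounded
    on a ball. Their bounds add up to a bound on the differential, and the mean value inequality is
    applied along lines. *)
Lemma smooth_on_lipschitz {E W : normedModType R} (D : set E) (F : E -> W) p0 :
  has_coordinates E -> open D -> D p0 -> smooth_on D F ->
  exists r L : R, [/\ 0 < r, 0 < L, forall p, `|p - p0| < r -> D p
    & forall p q, `|p - p0| < r -> `|q - p0| < r -> `|F p - F q| <= L * `|p - q|].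
Proof.
move=> [I [e [c ec]]] oD Dp0 FS.
pose M i := `|'D_(e i) F p0| + 1.
have M0 i : 0 < M i by rewrite ltr_wpDl.
have nearM : \forall p \near p0, D p /\ forall i, `|'D_(e i) F p| < M i.
  apply: filterI; first exact: open_nbhs_nbhs.
  apply: filter_forall => i; apply: (cvgr_lt `|'D_(e i) F p0|); last first.
    by rewrite ltrDl.
  have DC : {for p0, continuous ('D_(e i) F)}.
    by apply: differentiable_continuous; exact: (FS [:: e i]).
  by apply: cvg_norm; exact: DC.
have /nbhs_ballP[r /= r0 rM] := nearM.
have {}rM p : `|p - p0| < r -> D p /\ forall i, `|'D_(e i) F p| < M i.
  by move=> pr; apply: rM; rewrite -ball_normE /ball_ /= distrC.
pose C := \sum_i M i.
have C0 : 0 <= C by apply: sumr_ge0 => i _; exact: ltW.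
have FC p w : `|p - p0| < r -> `|'D_w F p| <= C * `|w|.
  move=> pr; have [Dp Mp] := rM _ pr.
  rewrite (ec w).1 derive_sum_coordinates; last exact: (FS [::] _ Dp).
  apply: (le_trans (ler_norm_sum _ _ _)); rewrite mulr_suml.
  apply: ler_sum => i _; rewrite normrZ mulrC -(ec w).1.
  by apply: ler_pM => //; [exact: ltW|exact: (ec w).2].
(* The mean value inequality runs over all [t] in [-1, 1], so [q + t (p - q)] may leave the segment
   from [q] to [p]; it stays within [r / 3 + 2 r / 3 = r] of [p0]. *)
exists (r / 3), (C + 1); split=> //; [by rewrite divr_gt0|by rewrite ltr_wpDl| |].
  by move=> p pr; apply: (rM p _).1; move: pr r0; lra.
move=> p q pr qr.
have seg (t : R) : `|t| <= `|1 : R| -> `|q + t *: (p - q) - p0| < r.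
  rewrite normr1 => t1; rewrite addrAC; apply: (le_lt_trans (ler_normD _ _)).
  have : `|t *: (p - q)| <= `|p - q| by rewrite normrZ ler_piMl.
  have : `|p - q| <= `|p - p0| + `|p0 - q| by exact: ler_distD.
  by move: pr qr; rewrite (distrC p0); lra.
have := @mean_value_le R W (fun t : R => F (q + t *: (p - q)))
  (fun t : R => 'D_(p - q) F (q + t *: (p - q))) (C * `|p - q|) 1.
rewrite scale1r scale0r addr0 (addrC q) subrK normr1 mulr1 => H.
apply: le_trans (H _ _) _; last by rewrite ler_wpM2r // lerDl.
  move=> t; rewrite -[X in _ <= X](normr1 R) => t1; apply: is_derive_comp.
    exact: is_derive_line.
  exact: (FS [::] _ (rM _ (seg _ t1)).1).
by move=> t; rewrite -[X in _ <= X](normr1 R) => t1; apply: FC; exact: seg.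
Qed.

End LocalLipschitz.

(** * Autonomous equations with a locally Lipschitz field: confinement and dependence on the
    datum *)

Section Flows.
Context {R : realType}.

Lemma is_derive_pair {V W : normedModType R} (f : R -> V) (g : R -> W) (t : R) v w :
  is_derive t 1 f v -> is_derive t 1 g w ->
  is_derive t 1 (fun t => (f t, g t)) (v, w).
Proof.
move=> [/derivable1_diffP fd fE] [/derivable1_diffP gd gE].
have fgd : differentiable (fun t => (f t, g t)) t by exact: differentiable_pair.
apply: DeriveDef; first by apply/derivable1_diffP.
by rewrite deriveE // diff_pair //= -(deriveE _ fd) -(deriveE _ gd) fE gE.
Qed.

Lemma is_derive_translate {V : normedModType R} (f : R -> V) (a t : R) v :
  is_derive (t + a) 1 f v -> is_derive t 1 (fun t => f (t + a)) v.
Proof.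
move=> [/derivable1_diffP fd <-].
exact: (is_derive_comp (is_derive_shift t 1 a) fd).
Qed.

Lemma prod_norm_le {V W : normedModType R} (p : V * W) (e : R) :
  (`|p| <= e) = (`|p.1| <= e) && (`|p.2| <= e).
Proof. by rewrite prod_normE ge_max. Qed.

Lemma prod_norm_lt {V W : normedModType R} (p : V * W) (e : R) :
  (`|p| < e) = (`|p.1| < e) && (`|p.2| < e).
Proof. by rewrite prod_normE gt_max. Qed.

Lemma prod_norm_pair0 {V W : normedModType R} (v : V) :
  `|(v, 0 : W)| = `|v|.
Proof. by rewrite prod_normE normr0 max_l. Qed.

Lemma prod_norm_fst {V W : normedModType R} (p : V * W) : `|p.1| <= `|p|.
Proof. by rewrite prod_normE le_max lexx. Qed.

Definition lipschitz_near {E W : normedModType R} (F : E -> W) (p0 : E) (r L : R) :=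
  forall p q, `|p - p0| < r -> `|q - p0| < r -> `|F p - F q| <= L * `|p - q|.

Context {E : normedModType R} (F : E -> E) (p0 : E) (r L : R).
Context (r0 : 0 < r) (L0 : 0 < L) (FL : lipschitz_near F p0 r L).

(** The field has norm below [M] on the ball, and a solution that has moved by at most
    [M * |s| <= rho / 2] is still in it, so the bootstrap closes. Smallness is expressed as a
    property of all [d] near [0^'+], so that several such conditions can be intersected as filter
    sets. *)
Lemma solution_stays_near (eta : R) : 0 < eta -> \forall d \near (0 : R)^'+,
  forall (x : R -> E) (s : R),
    (forall t : R, `|t| <= `|s| -> is_derive t 1 x (F (x t))) ->
    `|x 0 - p0| < d -> `|s| < d -> `|x s - p0| < eta.
Proof.
move=> eta0; pose rho := Num.min r eta; pose M := `|F p0| + L * r + 1.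
have rho0 : 0 < rho by rewrite lt_min r0.
have M0 : 0 < M by rewrite ltr_wpDl // addr_ge0 // mulr_ge0 // ltW.
have FM p : `|p - p0| < r -> `|F p| < M.
  move=> pr; rewrite -(subrK (F p0) (F p)); apply: (le_lt_trans (ler_normD _ _)).
  have : `|F p - F p0| <= L * `|p - p0| by apply: FL; rewrite ?subrr ?normr0.
  have : L * `|p - p0| <= L * r by rewrite ler_wpM2l // ltW.
  by rewrite /M; lra.
have d1 : \forall d \near (0 : R)^'+, d < rho / 2.
  by apply: nbhs_right_lt; rewrite divr_gt0.
have d2 : \forall d \near (0 : R)^'+, d < rho / 2 / M.
  by apply: nbhs_right_lt; rewrite !divr_gt0.
apply: (filterS _ (filterI d1 d2)) => d [{}d1 {}d2] x s xF x0 sd.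
have Ms : M * `|s| <= rho / 2.
  by rewrite mulrC -ler_pdivlMr //; apply/ltW/(lt_trans sd).
have near0 t : `|x t - x 0| <= M * `|s| -> `|x t - p0| < rho.
  move=> xt; apply: (le_lt_trans (ler_distD (x 0) _ _)).
  by move: xt Ms x0 d1; lra.
have : `|x s - x 0| <= M * `|s|.
  apply: mean_value_bootstrap xF _ => t ts xt; apply: FM.
  have : `|x t - p0| < rho.
    by apply: near0; apply: (le_trans xt); rewrite ler_wpM2l // ltW.
  by rewrite lt_min => /andP[].
by move/near0; rewrite lt_min => /andP[].
Qed.

(** Gronwall without forcing term. Equal initial data give uniqueness. *)
Lemma solutions_close (x y : R -> E) (s : R) : L * `|s| <= 1 / 2 ->
  (forall t : R, `|t| <= `|s| -> is_derive t 1 x (F (x t)) /\ `|x t - p0| < r) ->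
  (forall t : R, `|t| <= `|s| -> is_derive t 1 y (F (y t)) /\ `|y t - p0| < r) ->
  `|x s - y s| <= 2 * `|x 0 - y 0|.
Proof.
move=> Ls xF yF.
have := gronwall_short (e := 0) (ltW L0) Ls (fun t ts => (xF t ts).1)
          (fun t ts => (yF t ts).1).
rewrite mulr0 mul0r addr0; apply=> t ts; rewrite addr0.
by apply: FL; [exact: (xF t ts).2|exact: (yF t ts).2].
Qed.

End Flows.

(** * The contact curve as an orbit of [r k] *)

Section ContactCurve.
Context {R : realType} {h m : nat} (S : system R h m) (W : wave_curves R h m).
Local Notation V := 'cV[R]_(h + m).
Local Notation U := (sys_dom S).
Local Notation ustar := (sys_ref S).
Local Notation lambda := (sys_lambda S).
Local Notation r := (sys_r S).
Local Notation k := (sys_k S).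
Context (hS : system_hypotheses S) (hW : wave_curves_hypotheses S W).

(** A linearly degenerate field is not genuinely nonlinear, as one sees at [ustar]; hence the test
    in [tcurve] selects the integral curve for both signs of [s]. *)
Lemma tcurve_contact (u : V) (s : R) : tcurve S W k u s = icurve W k u s.
Proof.
have [[_ Us] _ _ _ [_ _ _ kld _]] := hS.
rewrite /tcurve; case: asboolP => //= kgn.
by have := kgn _ Us; rewrite kld // eqxx.
Qed.

Lemma gradient_dot n (F : 'cV[R]_n -> R) (u w : 'cV[R]_n) :
  differentiable F u -> ((gradient F u)^T *m w) 0 0 = 'D_w F u.
Proof.
have wE : w = \sum_i w i 0 *: (delta_mx i 0 : 'cV[R]_n).
  by rewrite {1}[w]matrix_sum_delta; apply: eq_bigr => i _; rewrite big_ord1.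
move=> Fd; rewrite [in RHS]wE derive_sum_coordinates //.
by rewrite mxE; apply: eq_bigr => i _; rewrite !mxE mulrC.
Qed.

(** Along the orbit, [lambda k] has derivative [grad lambda_k . r_k], which vanishes by linear
    degeneracy. *)
Lemma contact_speed_cst : \forall d \near (0 : R)^'+, forall (u : V) (s : R),
  `|u - ustar| < d -> `|s| < d -> lambda k (icurve W k u s) = lambda k u.
Proof.
have [_ _ _ _ [[lS _ _ _] _ _ kld _]] := hS.
have [[rho rho0 iW] _] := hW.
have d1 : \forall d \near (0 : R)^'+, d < rho by exact: nbhs_right_lt.
apply: filterS d1 => d dr u s ud sd.
have [i0 iU] := iW k u (lt_trans ud dr).
have ld w : U w -> differentiable (lambda k) w by exact: (lS k [::]).
have := @mean_value_le R R (fun t => lambda k (icurve W k u t)) (cst 0) 0 s.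
rewrite i0 mul0r normr_le0 subr_eq0 => H; apply/eqP/H => t ts; last by rewrite normr0.
have [Ut iD] := iU t (le_lt_trans ts (lt_trans sd dr)).
have := is_derive_comp iD (ld _ Ut).
by rewrite -gradient_dot ?kld //; exact: ld.
Qed.

Lemma eigenvector_lipschitz : exists rk L : R, [/\ 0 < rk, 0 < L,
  forall p, `|p - ustar| < rk -> U p & lipschitz_near (r k) ustar rk L].
Proof.
have [[oU Us] _ _ _ [[_ rS _ _] _ _ _ _]] := hS.
exact: (smooth_on_lipschitz (has_coordinates_cV _) oU Us (rS k)).
Qed.

Lemma contact_stays_near (eta : R) : 0 < eta -> \forall d \near (0 : R)^'+,
  forall (u : V) (s : R),
    `|u - ustar| < d -> `|s| < d -> `|icurve W k u s - ustar| < eta.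
Proof.
move=> eta0; have [rk [L [rk0 L0 _ rL]]] := eigenvector_lipschitz.
have [[rho rho0 iW] _] := hW.
have d1 : \forall d \near (0 : R)^'+, d < rho by exact: nbhs_right_lt.
apply: (filterS _ (filterI d1 (solution_stays_near rk0 L0 rL eta0))).
move=> d [{}d1 stay] u s ud sd.
have [i0 iU] := iW k u (lt_trans ud d1).
apply: stay => //; last by rewrite i0.
by move=> t ts; exact: (iU t (le_lt_trans ts (lt_trans sd d1))).2.
Qed.

(** As functions of [t], both sides solve the equation of the field [r k] with the same value at
    [t = 0], so uniqueness applies. *)
Lemma contact_translate : \forall d \near (0 : R)^'+, forall (u : V) (s t : R),
  `|u - ustar| < d -> `|s| < d -> `|t| < d ->
  icurve W k (icurve W k u s) t = icurve W k u (t + s).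
Proof.
have [rk [L [rk0 L0 _ rL]]] := eigenvector_lipschitz.
have [[rho rho0 iW] _] := hW.
(* Two scales: data and times below [e] keep orbits where [r k] is Lipschitz, while those below [d]
   keep the intermediate point and the total time [t + s] below [e]. *)
have [e /= [e0 [erho stay]]] : exists e, 0 < e /\ (e < rho /\ forall (u : V) (s : R),
    `|u - ustar| < e -> `|s| < e -> `|icurve W k u s - ustar| < rk).
  have e0 : \forall e \near (0 : R)^'+, 0 < e by exact: nbhs_right_gt.
  have e1 : \forall e \near (0 : R)^'+, e < rho by exact: nbhs_right_lt.
  have [e He] := filter_ex (filterI e0 (filterI e1 (contact_stays_near rk0))).
  by exists e.
have d1 : \forall d \near (0 : R)^'+, d < e / 2 by apply: nbhs_right_lt; rewrite divr_gt0.
have d2 : \forall d \near (0 : R)^'+, d < 1 / 2 / L.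
  by apply: nbhs_right_lt; rewrite !divr_gt0.
apply: (filterS _ (filterI d1 (filterI d2 (contact_stays_near e0)))).
move=> d [{}d1 [{}d2 staye]] u s t ud sd td.
have ue : `|u - ustar| < e by move: ud d1 e0; lra.
have te : `|t| < e by move: td d1 e0; lra.
have we := staye u s ud sd.
have [i0 iU] := iW k u (lt_trans ue erho).
have [j0 jU] := iW k _ (lt_trans we erho).
have Lt : L * `|t| <= 1 / 2.
  by rewrite mulrC -ler_pdivlMr //; apply/ltW/(lt_trans td).
have := solutions_close L0 rL (x := icurve W k (icurve W k u s))
  (y := fun t => icurve W k u (t + s)) Lt.
rewrite j0 add0r subrr normr0 mulr0 normr_le0 subr_eq0 => H; apply/eqP/H.
  move=> t' t't; have t'e := le_lt_trans t't te.
  by split; [exact: (jU _ (lt_trans t'e erho)).2 | exact: stay].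
move=> t' t't; have t'e : `|t' + s| < e.
  by apply: (le_lt_trans (ler_normD _ _)); move: t't td sd d1; lra.
split; last exact: stay.
by apply: is_derive_translate; exact: (iU _ (lt_trans t'e erho)).2.
Qed.

End ContactCurve.

(** * The center curve compared with the contact curve *)

Section CenterCurve.
Context {R : realType} {h m : nat} (S : system R h m) (W : wave_curves R h m).
Local Notation V := 'cV[R]_(h + m).
Local Notation ustar := (sys_ref S).
Local Notation lambda := (sys_lambda S).
Local Notation r := (sys_r S).
Local Notation k := (sys_k S).
Context (L : layer_construction R k).
Local Notation Omega := (lay_dom L).
Local Notation bk := (lay_b L).
Context (hS : system_hypotheses S) (hW : wave_curves_hypotheses S W).
Context (hC : center_component L) (hB : center_curve L).

(** The variable [sigma] is kept free: the center curve uses the value 0, whereas the field equals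
    [(r_k, 0)] at [z = 0] and [sigma = lambda_k]. *)
Definition center_field (p : V * R * R) : V * R :=
  (lay_rc L p.1.1 p.1.2 p.2, lay_theta L p.1.1 p.1.2 p.2).

Lemma center_field_lipschitz : exists rc C : R, [/\ 0 < rc, 0 < C,
  forall p, `|p - (ustar, 0, 0)| < rc -> Omega p &
  lipschitz_near center_field (ustar, 0, 0) rc C].
Proof.
have [[oO Os] [rcS thS] _ _ _] := hC.
have co : has_coordinates (V * R * R)%type.
  by do 2?apply: has_coordinates_prod; first exact: has_coordinates_cV;
    exact: has_coordinates_R.
have [r1 [C1 [r10 C10 O1 lip1]]] := smooth_on_lipschitz co oO Os rcS.
have [r2 [C2 [r20 C20 O2 lip2]]] := smooth_on_lipschitz co oO Os thS.
exists (Num.min r1 r2), (Num.max C1 C2); split.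
- by rewrite lt_min r10.
- by rewrite lt_max C10.
- by move=> p; rewrite lt_min => /andP[/O1].
move=> p q; rewrite !lt_min => /andP[p1 p2] /andP[q1 q2].
rewrite prod_norm_le; apply/andP; split.
  by apply: (le_trans (lip1 p q p1 q1)); rewrite ler_wpM2r // le_max lexx.
by apply: (le_trans (lip2 p q p2 q2)); rewrite ler_wpM2r // le_max lexx orbT.
Qed.

Lemma lipschitz_near_slice (rc C : R) : lipschitz_near center_field (ustar, 0, 0) rc C ->
  lipschitz_near (fun p => center_field (p, 0)) (ustar, 0) rc C.
Proof.
have E (p q : V * R) : (p, 0 : R) - (q, 0 : R) = (p - q, 0).
  by congr (_, _); rewrite /= subrr.
by move=> lip p q pr qr; have := lip (p, 0) (q, 0); rewrite !E !prod_norm_pair0; apply.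
Qed.

Lemma center_curve_solves : exists2 rho : R, 0 < rho &
  forall u : V, `|u - ustar| < rho -> bk u 0 = (u, 0) /\
    forall s : R, `|s| < rho -> is_derive s 1 (bk u) (center_field (bk u s, 0)).
Proof.
have [rho rho0 bW] := hB; exists rho => // u ur.
have [b0 bU] := bW u ur; split=> // s sr.
have [_ d1 d2] := bU s sr.
have -> : bk u = (fun t => ((bk u t).1, (bk u t).2)).
  by apply/funext => t; case: (bk u t).
exact: is_derive_pair.
Qed.

Lemma center_stays_near (eta : R) : 0 < eta -> \forall d \near (0 : R)^'+,
  forall (u : V) (s : R),
    `|u - ustar| < d -> `|s| < d -> `|bk u s - (ustar, 0)| < eta.
Proof.
move=> eta0; have [rc [C [rc0 C0 _ /lipschitz_near_slice lip]]] := center_field_lipschitz.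
have [rho rho0 bW] := center_curve_solves.
have d1 : \forall d \near (0 : R)^'+, d < rho by exact: nbhs_right_lt.
apply: (filterS _ (filterI d1 (solution_stays_near rc0 C0 lip eta0))).
move=> d [{}d1 stay] u s ud sd.
have [b0 bU] := bW u (lt_trans ud d1).
apply: stay => //; last first.
  have -> : bk u 0 - (ustar, 0) = (u - ustar, 0).
    by rewrite b0; congr (_, _); rewrite /= subrr.
  by rewrite prod_norm_pair0.
by move=> t ts; exact: bU t (le_lt_trans ts (lt_trans sd d1)).
Qed.

(** Follows from [lambda k ustar = 0]. It places the points [(w, 0, lambda k w)] in the ball where
    the center field is defined and Lipschitz. *)
Lemma lambda_small (eta : R) : 0 < eta -> \forall d \near (0 : R)^'+,
  forall u : V, `|u - ustar| < d -> `|lambda k u| < eta.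
Proof.
move=> eta0; have [[oU Us] _ _ _ [[lS _ _ _] [l0 _] _ _ _]] := hS.
have [r1 [C1 [r10 C10 _ lip]]] := smooth_on_lipschitz (has_coordinates_cV _) oU Us (lS k).
have d1 : \forall d \near (0 : R)^'+, d < r1 by exact: nbhs_right_lt.
have d2 : \forall d \near (0 : R)^'+, d < eta / C1.
  by apply: nbhs_right_lt; rewrite divr_gt0.
apply: (filterS _ (filterI d1 d2)) => d [{}d1 {}d2] u ud.
have := lip u ustar (lt_trans ud d1); rewrite subrr normr0 l0 subr0 => /(_ r10) H.
apply: (le_lt_trans H); rewrite mulrC -ltr_pdivlMr //; exact: lt_trans d2.
Qed.

(* The contact curve, on which [lambda k] is constant, solves the equation of the
   center curve up to an error of order [lambda k u]. *)
Lemma center_vs_contact : exists2 C : R, 0 < C & \forall d \near (0 : R)^'+,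
  forall (u : V) (s : R), `|u - ustar| < d -> `|s| < d ->
    `|bk u s - (icurve W k u s, 0)| <= C * `|s| * `|lambda k u|.
Proof.
have [rc [C [rc0 C0 OC lipH]]] := center_field_lipschitz.
have lip := lipschitz_near_slice lipH.
have [rho rho0 bW] := center_curve_solves.
have [[rho' rho'0 iW] _] := hW.
have [_ _ _ rck _] := hC.
exists (2 * C); first by rewrite mulr_gt0.
have d1 : \forall d \near (0 : R)^'+, d < rho by exact: nbhs_right_lt.
have d2 : \forall d \near (0 : R)^'+, d < rho' by exact: nbhs_right_lt.
have d3 : \forall d \near (0 : R)^'+, d < 1 / 2 / C.
  by apply: nbhs_right_lt; rewrite !divr_gt0.
apply: (filterS _ (filterI d1 (filterI d2 (filterI d3
  (filterI (center_stays_near rc0) (filterI (contact_stays_near hS hW rc0)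
  (filterI (lambda_small rc0) (contact_speed_cst hS hW)))))))).
move=> d [{}d1 [{}d2 [{}d3 [bstay [istay [lsmall lcst]]]]]] u s ud sd.
have [b0 bU] := bW u (lt_trans ud d1).
have [i0 iU] := iW k u (lt_trans ud d2).
have Cs : C * `|s| <= 1 / 2.
  by rewrite mulrC -ler_pdivlMr //; apply/ltW/(lt_trans sd).
have := gronwall_short (x := bk u) (y := fun t => (icurve W k u t, 0 : R))
  (dx := fun t => center_field (bk u t, 0))
  (dy := fun t => (r k (icurve W k u t), 0 : R)) (e := C * `|lambda k u|) (ltW C0) Cs.
rewrite b0 i0 subrr normr0 mulr0 add0r => H.
have -> : 2 * C * `|s| * `|lambda k u| = 2 * (C * `|lambda k u|) * `|s| by ring.
apply: H => t ts; have td := le_lt_trans ts sd.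
- exact: bU t (lt_trans td d1).
- by apply: is_derive_pair; exact: (iU t (lt_trans td d2)).2.
set w := icurve W k u t; have wE : lambda k w = lambda k u by exact: lcst.
have wr : `|w - ustar| < rc by exact: istay.
have pE (p : V * R) (z : R) : (p, z) - (ustar, 0, 0) = (p - (ustar, 0), z) :> V * R * R.
  by congr (_, _); rewrite /= subr0.
have w0E : (w, 0 : R) - (ustar, 0) = (w - ustar, 0) by congr (_, _); rewrite /= subr0.
have w0r : `|(w, 0 : R) - (ustar, 0)| < rc by rewrite w0E prod_norm_pair0.
have wlr : `|(w, 0 : R, lambda k w) - (ustar, 0, 0)| < rc.
  by rewrite pE prod_norm_lt /= w0r wE lsmall.
have [th0 rcE] := rck _ (OC _ wlr).
have -> : (r k w, 0 : R) = center_field (w, 0, lambda k w).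
  by rewrite /center_field /= th0 rcE.
(* The first term is the Lipschitz bound in [(u, z)] at [sigma = 0]; the second moves [sigma] from 0
   to [lambda k w] and is the forcing term of Gronwall. *)
apply: (le_trans (ler_distD (center_field (w, 0, 0)) _ _)); apply: lerD.
  by apply: (lip (bk u t) (w, 0)) => //; exact: bstay.
rewrite -wE; apply: le_trans (lipH _ _ _ wlr) _.
  by rewrite pE prod_norm_pair0.
rewrite ler_wpM2l ?(ltW C0) //.
have -> : (w, 0 : R, 0 : R) - (w, 0, lambda k w) = ((0, 0), - lambda k w).
  by congr (_, _); rewrite /= ?subrr ?sub0r.
by rewrite prod_norm_le /= normrN lexx prod_norm_le /= !normr0 normr_ge0.
Qed.

(** As functions of [t], the two curves solve the same autonomous equation. Their data [bk u s] and
    [(icurve W k u s, 0)] are close by [center_vs_contact], and Gronwall at most doubles this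
    distance. *)
Lemma center_shift : exists2 C : R, 0 < C & \forall d \near (0 : R)^'+,
  forall (u : V) (s t : R), `|u - ustar| < d -> `|s| < d -> `|t| < d ->
    `|bk u (t + s) - bk (icurve W k u s) t| <= C * `|s| * `|lambda k u|.
Proof.
have [rc [C [rc0 C0 _ /lipschitz_near_slice lip]]] := center_field_lipschitz.
have [rho rho0 bW] := center_curve_solves.
have [C' C'0 bi] := center_vs_contact; exists (2 * C'); first by rewrite mulr_gt0.
have [e /= [e0 [erho stay]]] : exists e, 0 < e /\ (e < rho /\ forall (u : V) (s : R),
    `|u - ustar| < e -> `|s| < e -> `|bk u s - (ustar, 0)| < rc).
  have e0 : \forall e \near (0 : R)^'+, 0 < e by exact: nbhs_right_gt.
  have e1 : \forall e \near (0 : R)^'+, e < rho by exact: nbhs_right_lt.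
  have [e He] := filter_ex (filterI e0 (filterI e1 (center_stays_near rc0))).
  by exists e.
have d1 : \forall d \near (0 : R)^'+, d < e / 2 by apply: nbhs_right_lt; rewrite divr_gt0.
have d2 : \forall d \near (0 : R)^'+, d < 1 / 2 / C.
  by apply: nbhs_right_lt; rewrite !divr_gt0.
apply: (filterS _ (filterI d1 (filterI d2
  (filterI bi (contact_stays_near hS hW e0))))).
move=> d [{}d1 [{}d2 [{}bi istay]]] u s t ud sd td.
have ue : `|u - ustar| < e by move: ud d1 e0; lra.
have te : `|t| < e by move: td d1 e0; lra.
have we := istay u s ud sd.
have [b0 bU] := bW u (lt_trans ue erho).
have [c0 cU] := bW _ (lt_trans we erho).
have Ct : C * `|t| <= 1 / 2.
  by rewrite mulrC -ler_pdivlMr //; apply/ltW/(lt_trans td).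
have := solutions_close C0 lip (x := fun t => bk u (t + s))
  (y := bk (icurve W k u s)) Ct.
rewrite c0 add0r => H; have := bi u s ud sd.
suff : `|bk u (t + s) - bk (icurve W k u s) t| <= 2 * `|bk u s - (icurve W k u s, 0)|.
  by lra.
apply: H => t' t't.
  have t'e : `|t' + s| < e.
    by apply: (le_lt_trans (ler_normD _ _)); move: t't td sd d1; lra.
  split; last exact: stay.
  by apply: is_derive_translate; exact: bU _ (lt_trans t'e erho).
have t'e := le_lt_trans t't te.
by split; [exact: cU _ (lt_trans t'e erho) | exact: stay].
Qed.

Lemma gamma_stays_near (eta : R) : 0 < eta -> \forall d \near (0 : R)^'+,
  forall (u : V) (s : R),
    `|u - ustar| < d -> `|s| < d -> `|gamma W L u s - (ustar, 0)| < eta.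
Proof.
move=> eta0.
apply: (filterS _ (filterI (center_stays_near eta0) (contact_stays_near hS hW eta0))).
move=> d [bstay istay] u s ud sd; rewrite /gamma; case: ifP => _; last exact: bstay.
have -> : (tcurve S W k u s, 0 : R) - (ustar, 0) = (tcurve S W k u s - ustar, 0).
  by congr (_, _); rewrite /= subr0.
by rewrite prod_norm_pair0 tcurve_contact //; exact: istay.
Qed.

(** Since [lambda k] is constant on the contact curve, both occurrences of [gamma] take the same
    branch. For [lambda k u >= 0] the difference vanishes by the translation property; otherwise
    [center_shift] applies and [|lambda k u|] is the negative part. *)
Lemma gamma_shift : exists2 C : R, 0 < C & \forall d \near (0 : R)^'+,
  forall (u : V) (s t : R), `|u - ustar| < d -> `|s| < d -> `|t| < d ->
    `|gamma W L u (t + s) - gamma W L (tcurve S W k u s) t|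
      <= C * `|s| * neg_part (lambda k u).
Proof.
have [C C0 bs] := center_shift; exists C => //.
apply: (filterS _ (filterI bs
  (filterI (contact_translate hS hW) (contact_speed_cst hS hW)))).
move=> d [{}bs [it lcst]] u s t ud sd td.
rewrite /gamma !tcurve_contact // lcst //.
have [lu|lu] := leP 0 (lambda k u).
  rewrite it // subrr normr0 !mulr_ge0 // ?(ltW C0) //.
  by rewrite /neg_part le_max lexx orbT.
rewrite /neg_part max_l ?oppr_ge0 ?(ltW lu) // -(ltr0_norm lu).
exact: bs.
Qed.

End CenterCurve.

(** * Auxiliary bounds on parameters, projections and fast waves *)

(** The threshold is uniform over dimensions up to [N], because the number [k - ell S ub] of
    parameters varies with [ub]. The denominator [N.+1] covers [N = 0]. *)
Lemma norm1_small {R : realType} (N : nat) (eta : R) : 0 < eta ->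
  \forall d \near (0 : R)^'+, forall n (x : 'cV[R]_n), (n <= N)%N ->
    (forall i, `|x i 0| < d) -> norm1 x < eta.
Proof.
move=> eta0.
have d0 : \forall d \near (0 : R)^'+, 0 < d by exact: nbhs_right_gt.
have d1 : \forall d \near (0 : R)^'+, d < eta / N.+1%:R.
  by apply: nbhs_right_lt; rewrite divr_gt0.
apply: (filterS _ (filterI d0 d1)) => d [{}d0 {}d1] n x nN xd.
apply: (@le_lt_trans _ _ (d * N%:R)).
  apply: (@le_trans _ _ (\sum_(i < n) d)); first by apply: ler_sum => i _; exact: ltW.
  by rewrite sumr_const card_ord -[d *+ _]mulr_natr ler_wpM2l ?ler_nat // ltW.
move: d1; rewrite ltr_pdivlMr // => /(le_lt_trans _); apply.
by rewrite ler_wpM2l ?ler_nat // ltW.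
Qed.

Lemma norm_bproj_le {R : realType} {h m : nat} (S : system R h m)
    (ub w : 'cV[R]_(h + m)) : `|bproj S ub *m w| <= `|w|.
Proof.
rewrite /bproj; case: ifP => _; first by rewrite mul1mx.
rewrite -{1}[w]vsubmxK mul_block_col !mul0mx mul1mx !add0r.
rewrite {1}/Num.norm /= mx_normrE; apply: bigmax_le => // -[i j] _ /=.
rewrite mxE; case: splitP => i' _; first by rewrite mxE normr0.
by rewrite mxE; exact: norm_coord_le.
Qed.

(** At parameter 0 both kinds of curve return their base point, so each factor of the composition is
    the identity at [u]. *)
Lemma fast_waves0 {R : realType} {h m : nat} (S : system R h m)
    (W : wave_curves R h m) : wave_curves_hypotheses S W ->
  \forall d \near (0 : R)^'+, forall u s, `|u - sys_ref S| < d ->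
    (forall i : 'I_(h + m), (sys_k S < i)%N -> s i = 0) -> fast_waves S W u s = u.
Proof.
move=> [[rho rho0 iW] [[rho' rho'0 hW] _]].
have d1 : \forall d \near (0 : R)^'+, d < rho by exact: nbhs_right_lt.
have d2 : \forall d \near (0 : R)^'+, d < rho' by exact: nbhs_right_lt.
apply: (filterS _ (filterI d1 d2)) => d [{}d1 {}d2] u s ud s0.
rewrite /fast_waves.
have := filter_all (fun i : 'I_(h + m) => (sys_k S < i)%N) (enum 'I_(h + m)).
elim: [seq _ <- _ | _] => //= i l IH /andP[ki /IH ->].
rewrite /tcurve s0 //; case: ifP => _.
  by have [_ /(_ _ (lt_trans ud d2))[]] := hW i.
by have [] := iW i u (lt_trans ud d1).
Qed.

(** * Comparison of parameters through the Lipschitz inverse of the full map *)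

Theorem lemma6p3 (R : realType) (h m : nat) (S : system R h m)
    (W : wave_curves R h m) (L : layer_construction R (sys_k S))
    (hS : system_hypotheses S) (hW : wave_curves_hypotheses S W)
    (hL : layer_hypotheses W L) :
  exists2 C10 : R, 0 < C10 & exists2 delta : R, 0 < delta &
    forall (up ubar ub : 'cV[R]_(h + m)) (sk : R)
      (xi : 'cV[R]_(sys_k S - ell S ub)) (xik : R)
      (xi' : 'cV[R]_(sys_k S - ell S ub)) (s' : 'I_(h + m) -> R),
      `|up - sys_ref S| < delta -> `|ubar - sys_ref S| < delta ->
      `|ub - sys_ref S| < delta ->
      `|sk| < delta -> (forall i, `|xi i 0| < delta) -> `|xik| < delta ->
      (forall i, `|xi' i 0| < delta) ->
      (forall i : 'I_(h + m), (sys_k S <= i)%N -> `|s' i| < delta) ->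
      ubar = tcurve S W (sys_k S) up sk ->
      beta S (phi W L ubar xi xik) ub = 0 ->
      beta S (full_map W L up xi' s') ub = 0 ->
      \sum_i `|xi i 0 - xi' i 0| + `|s' (sys_k S) - (xik + sk)|
        + \sum_(i < h + m | (sys_k S < i)%N) `|s' i|
      <= C10 * `|sk| * (`|xik| + neg_part (sys_lambda S (sys_k S) up)).
Proof.
have [[hC hB] [rS [_ [lS [_ [_ [[rS0 _ _] psisL _ _]]]]]]
  [rP [lP [_ [rP0 psipL _]]]] _ [rI [rI' [lI [rI0 _ inv]]]]] := hL.
have [C C0 shift] := gamma_shift hS hW hC hB.
set k := sys_k S; set ustar := sys_ref S.
pose e := Num.min rS rP.
have e0 : 0 < e by rewrite lt_min rS0.
have [d' [d'0 stay]] : exists d, 0 < d /\ forall u s,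
    `|u - ustar| < d -> `|s| < d -> `|gamma W L u s - (ustar, 0)| < e.
  have d0 : \forall d \near (0 : R)^'+, 0 < d by exact: nbhs_right_gt.
  have [d [d1 d2]] := filter_ex (filterI d0 (gamma_stays_near hS hW hC hB e0)).
  by exists d.
(* The factors bound the inverse of the full map, the dependence of [phi] on [gamma] at fixed [xi],
   and the shift of [gamma]. The 2 arises because [psi_p] sees [gamma] both directly and through
   [zeta]. Absolute values and added ones make up for Lipschitz constants of unknown sign. *)
exists ((`|lI| + 1) * (`|lS| + 2 * `|lP| + 1) * C).
  by rewrite !mulr_gt0 // ltr_wpDl // addr_ge0 // mulr_ge0.
have d0 : \forall d \near (0 : R)^'+, 0 < d by exact: nbhs_right_gt.
have d1 : \forall d \near (0 : R)^'+, d < d' / 2.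
  by apply: nbhs_right_lt; rewrite divr_gt0.
have d2 : \forall d \near (0 : R)^'+, d < e by exact: nbhs_right_lt.
have d3 : \forall d \near (0 : R)^'+, d < rI / 2.
  by apply: nbhs_right_lt; rewrite divr_gt0.
have [d [{}d0 [{}d1 [{}d2 [{}d3 [small1 [small2 [{}shift fast0]]]]]]]] :=
  filter_ex (filterI d0 (filterI d1 (filterI d2 (filterI d3
    (filterI (norm1_small (h + m) e0) (filterI (norm1_small (h + m) rI0)
    (filterI shift (fast_waves0 hW)))))))).
exists d => // up ubar ub sk xi xik xi' s' upd ubard ubd skd xid xikd xi'd s'd
  ubarE /beta_eq0 b1 /beta_eq0 b2.
have kl : (k - ell S ub <= h + m)%N.
  by apply: (leq_trans (leq_subr _ _)); exact/ltnW/ltn_ord.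
(* Comparison parameters: no fast waves, and the two pieces of the [k]-th curve joined into one of
   length [xik + sk]. *)
pose s (i : 'I_(h + m)) : R := if i == k then xik + sk else 0.
have sI i : `|s i| < rI.
  rewrite /s; case: eqP => _; last by rewrite normr0.
  by apply: (le_lt_trans (ler_normD _ _)); move: xikd skd d3; lra.
have fastE : fast_waves S W up s = up.
  apply: fast0 => // i ki; rewrite /s; case: eqP => // ik.
  by move: ki; rewrite ik ltnn.
have dI : d < rI by move: d3 rI0; lra.
have [/(_ xi' xi s' s) H _] := inv ub up (lt_trans ubd dI) (lt_trans upd dI).
have {}H := H (small2 _ _ kl xi'd) (small2 _ _ kl xid)
  (fun i ki => conj (lt_trans (s'd i ki) dI) (sI i)).
(* Both boundary conditions give the same projection [P ub]; the value at [(xi', s')] is thus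
   replaced by [phi] at [ubar], and only its distance to the value at [(xi, s)] remains. *)
rewrite b2 -b1 -mulmxBr in H.
have sum1 : \sum_i `|xi i 0 - xi' i 0| = norm1 (xi' - xi).
  by apply: eq_bigr => i _; rewrite !mxE distrC.
have sum2 : \sum_(i < h + m | (k <= i)%N) `|s' i - s i| =
    `|s' k - (xik + sk)| + \sum_(i < h + m | (k < i)%N) `|s' i|.
  rewrite (bigD1 k) //= {1}/s eqxx; congr (_ + _).
  apply: eq_big => [i|i]; first by rewrite andbC eq_sym -val_eqE /= -ltn_neqAle.
  by case/andP => _ /negbTE ik; rewrite /s ik subr0.
rewrite -/k -addrA -sum2 sum1; apply: (le_trans H).
set g1 := gamma W L up (xik + sk); set g2 := gamma W L ubar xik.
have skd' : `|xik + sk| < d'.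
  by apply: (le_lt_trans (ler_normD _ _)); move: xikd skd d1; lra.
have dd' : d < d' by move: d1 d'0; lra.
have g1e : `|g1 - (ustar, 0)| < e by apply: stay => //; exact: lt_trans dd'.
have g2e : `|g2 - (ustar, 0)| < e by apply: stay; exact: lt_trans dd'.
have eS : e <= rS by rewrite ge_min lexx.
have eP : e <= rP by rewrite ge_min lexx orbT.
have z1e : `|g1.1 - ustar| < e := le_lt_trans (prod_norm_fst _) g1e.
have z2e : `|g2.1 - ustar| < e := le_lt_trans (prod_norm_fst _) g2e.
have xie : norm1 xi < e := small1 _ _ kl xid.
have n0 : norm1 (xi - xi) = 0.
  by rewrite /norm1 big1 // => i _; rewrite subrr mxE normr0.
have ube := lt_trans ubd d2.
have gE : `|g1.1 - g2.1| <= `|g1 - g2| := prod_norm_fst (g1 - g2).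
have psisE : `|lay_psis L g1.1 xi - lay_psis L g2.1 xi| <= `|lS| * `|g1 - g2|.
  apply: le_trans (psisL ub _ _ xi xi _ _ _ _ _) _; do ?exact: lt_le_trans eS.
  rewrite n0 addr0; apply: (@le_trans _ _ (`|lS| * `|g1.1 - g2.1|)).
    by rewrite ler_wpM2r // ler_norm.
  by rewrite ler_wpM2l.
have psipE : `|lay_psip L g1.1 g1 xi - lay_psip L g2.1 g2 xi| <= `|lP| * (2 * `|g1 - g2|).
  apply: le_trans (psipL ub _ _ _ _ xi xi _ _ _ _ _ _ _) _; do ?exact: lt_le_trans eP.
  rewrite n0 addr0; apply: (@le_trans _ _ (`|lP| * (`|g1.1 - g2.1| + `|g1 - g2|))).
    by rewrite ler_wpM2r ?ler_norm // addr_ge0.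
  by rewrite ler_wpM2l //; move: gE; lra.
have phiE : `|phi W L ubar xi xik - full_map W L up xi s|
    <= (`|lS| + 2 * `|lP| + 1) * `|g1 - g2|.
  rewrite distrC /full_map fastE /s eqxx /phi /zeta -/g1 -/g2 opprD addrACA.
  apply: (le_trans (ler_normD _ _)).
  have : 0 <= `|g1 - g2| by [].
  by move: psisE psipE; lra.
have {phiE} := le_trans (norm_bproj_le S ub _) phiE.
set y := `|bproj S ub *m _| => yE.
(* [gamma_shift] bounds the difference by the negative part; adding the nonnegative [|xik|] gives
   the stated form. *)
have g12 : `|g1 - g2| <= C * `|sk| * (`|xik| + neg_part (sys_lambda S k up)).
  rewrite /g2 ubarE; apply: (le_trans (shift up sk xik upd skd xikd)).
  by rewrite ler_wpM2l ?mulr_ge0 ?(ltW C0) // lerDr.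
apply: (@le_trans _ _ ((`|lI| + 1) * y)).
  by apply: ler_wpM2r; [exact: normr_ge0|have := ler_norm lI; lra].
have assoc (a b c t x : R) : a * b * c * t * x = a * (b * (c * t * x)) by ring.
rewrite assoc; apply: ler_wpM2l; first by rewrite addr_ge0.
by apply: (le_trans yE); apply: ler_wpM2l => //; rewrite !addr_ge0 // mulr_ge0.
Qed.
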